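(* For every $x\in[-\pi/2,\pi/2]$, $$\left(\frac{x}{\sin x}\right)^2+\left(\frac{\pi^2}{4}-1\right)\frac{x}{\tan x}\le \frac{\pi^2}{4},$$ and equality is attained at $x=-\pi/2$, $x=0$ and $x=\pi/2$.
   Context: The functions are extended by their limits: $\frac{x}{\sin x}=1$ and $\frac{x}{\tan x}=1$ at $x=0$, and $\frac{x}{\tan x}=\frac{x\cos x}{\sin x}=0$ at $x=\pm\pi/2$. *)

(* Defs.v *)
From Stdlib Require Import Reals.
Open Scope R_scope.

(* x / sin x, extended by its limit 1 at x = 0. *)
Definition x_over_sin (x : R) : R :=
  if Req_dec_T x 0 then 1 else x / sin x.

(* x / tan x, extended by its limits 1 at x = 0 and 0 at x = PI/2, -PI/2.
   The latter points need their own case: Stdlib's total [tan] has no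
   meaningful value where [cos] vanishes. *)
Definition x_over_tan (x : R) : R :=
  if Req_dec_T x 0 then 1
  else if Req_dec_T x (PI / 2) then 0
  else if Req_dec_T x (- (PI / 2)) then 0
  else x / tan x.

(* Main.v *)
(** Put [k = PI^2/4 - 1].  Multiplied by [sin x ^ 2], the inequality for
    [0 < x < PI/2] says that
    [F x = (k+1) sin^2 x - x^2 - k x sin x cos x] is nonnegative.  Now
    [F'' x = 4 sin x (k x cos x - sin x)], and a function vanishing at [0] whose
    derivative changes sign at most once, from [+] to [-], has the same
    property.  This passes from [(k x cos x - sin x)'] up to [F] in three
    integrations, and [F (PI/2) = 0] then forces [F >= 0]. *)
Require Import Defs.
From Stdlib Require Import Reals Lra.
From Coquelicot Require Import Coquelicot.
Open Scope R_scope.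

(** Encoding the sign change as backward propagation of nonnegativity avoids naming the switching
    point and lets either phase be empty. *)
Definition plus_then_minus (b : R) (f : R -> R) : Prop :=
  forall x y, 0 < x -> x <= y -> y <= b -> 0 <= f y -> 0 <= f x.

(** If [f x < 0 <= f y], the mean value theorem gives [c] in [(0, x)] with [f' c < 0] and [d] in
    [(x, y)] with [f' d > 0], against the sign pattern of [f']. *)
Lemma plus_then_minus_integral (b : R) (f f' : R -> R) :
  (forall x, is_derive f x (f' x)) -> f 0 = 0 ->
  plus_then_minus b f' -> plus_then_minus b f.
Proof.
  intros Hd H0 Hf' x y Hx Hxy Hy Hfy.
  destruct (Rle_lt_dec 0 (f x)) as [H | Hneg]; [exact H |].
  assert (Hlt : x < y).
  { destruct Hxy as [H | H]; [exact H | subst y; lra]. }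
  assert (Hl : forall c, derivable_pt_lim f c (f' c)).
  { intro c; apply is_derive_Reals, Hd. }
  destruct (MVT_cor2 f f' 0 x Hx (fun c _ => Hl c)) as [c [Hc Hc']].
  destruct (MVT_cor2 f f' x y Hlt (fun c _ => Hl c)) as [d [Hd1 Hd']].
  assert (0 <= f' c) by (apply (Hf' c d); nra).
  nra.
Qed.

Lemma sin_pos_half (x : R) : 0 < x -> x <= PI / 2 -> 0 < sin x.
Proof. intros H1 H2. apply sin_gt_0; lra. Qed.

(** For [k >= 1] the function is decreasing on [(0, PI/2]]: [cos x] decreases while [x * sin x]
    increases. *)
Lemma gap_deriv_plus_then_minus (k : R) : 1 <= k ->
  plus_then_minus (PI / 2) (fun x => (k - 1) * cos x - k * (x * sin x)).
Proof.
  intros Hk x y Hx Hxy Hy H.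
  assert (Hc : cos y <= cos x) by (apply cos_decr_1; lra).
  assert (Hs : sin x <= sin y) by (apply sin_incr_1; lra).
  assert (0 < sin x) by (apply sin_pos_half; lra).
  assert (x * sin x <= y * sin y) by (apply Rmult_le_compat; lra).
  nra.
Qed.

Lemma gap_plus_then_minus (k : R) : 1 <= k ->
  plus_then_minus (PI / 2) (fun x => k * x * cos x - sin x).
Proof.
  intro Hk.
  apply (plus_then_minus_integral _ _
           (fun x => (k - 1) * cos x - k * (x * sin x))).
  - intro x; auto_derive; [exact I | ring].
  - rewrite sin_0; ring.
  - apply gap_deriv_plus_then_minus; exact Hk.
Qed.

Lemma cleared_plus_then_minus (k : R) : 1 <= k ->
  plus_then_minus (PI / 2)
    (fun x => (k + 1) * sin x ^ 2 - x ^ 2 - k * x * sin x * cos x).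
Proof.
  intro Hk.
  (* This is the first derivative of [F]; the next application descends to the second. *)
  apply (plus_then_minus_integral _ _
    (fun x => (k + 2) * (sin x * cos x) - 2 * x
              - k * x * (cos x ^ 2 - sin x ^ 2))).
  { intro x; auto_derive; [exact I | ring]. }
  { rewrite sin_0; ring. }
  apply (plus_then_minus_integral _ _
    (fun x => 4 * sin x * (k * x * cos x - sin x))).
  { intro x; auto_derive; [exact I |].
    assert (E : cos x ^ 2 = 1 - sin x ^ 2).
    { generalize (sin2_cos2 x); unfold Rsqr; intro; lra. }
    ring_simplify; rewrite E; ring. }
  { rewrite sin_0; ring. }
  (* Since [4 * sin x > 0], the second derivative has the sign of [k * x * cos x - sin x]. *)
  intros x y Hx Hxy Hy H.
  assert (0 < sin x) by (apply sin_pos_half; lra).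
  assert (0 < sin y) by (apply sin_pos_half; lra).
  assert (0 <= k * x * cos x - sin x).
  { apply (gap_plus_then_minus k Hk x y Hx Hxy Hy); nra. }
  nra.
Qed.

Lemma cleared_nonneg (x : R) : 0 < x <= PI / 2 ->
  x ^ 2 + (PI ^ 2 / 4 - 1) * x * sin x * cos x <= PI ^ 2 / 4 * sin x ^ 2.
Proof.
  intros [Hx Hx2].
  (* [PI / 2 > 3/2] gives [PI ^ 2 / 4 > 9/4]. *)
  assert (Hk : 1 <= PI ^ 2 / 4 - 1) by (generalize PI2_3_2; nra).
  enough (0 <= (PI ^ 2 / 4 - 1 + 1) * sin x ^ 2 - x ^ 2
               - (PI ^ 2 / 4 - 1) * x * sin x * cos x) by lra.
  apply (cleared_plus_then_minus _ Hk x (PI / 2) Hx Hx2 (Rle_refl _)).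
  rewrite sin_PI2, cos_PI2; right; field.
Qed.

Lemma x_over_sin_opp (x : R) : x_over_sin (- x) = x_over_sin x.
Proof.
  unfold x_over_sin.
  destruct (Req_dec_T (- x) 0), (Req_dec_T x 0); try lra.
  rewrite sin_neg; unfold Rdiv; rewrite Rinv_opp; ring.
Qed.

Lemma x_over_tan_opp (x : R) : x_over_tan (- x) = x_over_tan x.
Proof.
  unfold x_over_tan.
  destruct (Req_dec_T (- x) 0), (Req_dec_T x 0); try lra.
  (* Negation swaps the two exceptional points, where both values are 0. *)
  destruct (Req_dec_T (- x) (PI / 2)), (Req_dec_T (- x) (- (PI / 2))),
    (Req_dec_T x (PI / 2)), (Req_dec_T x (- (PI / 2))); try lra.
  rewrite tan_neg; unfold Rdiv; rewrite Rinv_opp; ring.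
Qed.

Lemma equality_at_0 :
  x_over_sin 0 ^ 2 + (PI ^ 2 / 4 - 1) * x_over_tan 0 = PI ^ 2 / 4.
Proof.
  unfold x_over_sin, x_over_tan.
  destruct (Req_dec_T 0 0); [field | lra].
Qed.

Lemma equality_at_PI2 :
  x_over_sin (PI / 2) ^ 2 + (PI ^ 2 / 4 - 1) * x_over_tan (PI / 2)
  = PI ^ 2 / 4.
Proof.
  generalize PI_RGT_0; intro.
  unfold x_over_sin, x_over_tan.
  destruct (Req_dec_T (PI / 2) 0); [lra |].
  destruct (Req_dec_T (PI / 2) (PI / 2)); [| lra].
  rewrite sin_PI2; field.
Qed.

Lemma inequality_pos (x : R) : 0 < x < PI / 2 ->
  x_over_sin x ^ 2 + (PI ^ 2 / 4 - 1) * x_over_tan x <= PI ^ 2 / 4.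
Proof.
  intros [Hx Hx2].
  unfold x_over_sin, x_over_tan.
  destruct (Req_dec_T x 0); [lra |].
  destruct (Req_dec_T x (PI / 2)); [lra |].
  destruct (Req_dec_T x (- (PI / 2))); [lra |].
  assert (Hs : 0 < sin x) by (apply sin_pos_half; lra).
  (* A nonzero cosine allows [x / tan x] to be rewritten as [x * cos x / sin x]. *)
  assert (Hc : 0 < cos x) by (apply cos_gt_0; lra).
  apply Rmult_le_reg_r with (sin x ^ 2); [apply pow_lt; exact Hs |].
  replace (((x / sin x) ^ 2 + (PI ^ 2 / 4 - 1) * (x / tan x)) * sin x ^ 2)
    with (x ^ 2 + (PI ^ 2 / 4 - 1) * x * sin x * cos x)
    by (unfold tan; field; lra).
  apply cleared_nonneg; lra.
Qed.

Theorem theorem1p9 :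
  (forall x : R, - (PI / 2) <= x <= PI / 2 ->
     x_over_sin x ^ 2 + (PI ^ 2 / 4 - 1) * x_over_tan x <= PI ^ 2 / 4) /\
  (forall x : R, x = - (PI / 2) \/ x = 0 \/ x = PI / 2 ->
     x_over_sin x ^ 2 + (PI ^ 2 / 4 - 1) * x_over_tan x = PI ^ 2 / 4).
Proof.
  assert (Heq : forall x : R, x = - (PI / 2) \/ x = 0 \/ x = PI / 2 ->
     x_over_sin x ^ 2 + (PI ^ 2 / 4 - 1) * x_over_tan x = PI ^ 2 / 4).
  { intros x [-> | [-> | ->]].
    - rewrite x_over_sin_opp, x_over_tan_opp; exact equality_at_PI2.
    - exact equality_at_0.
    - exact equality_at_PI2. }
  split; [| exact Heq].
  intros x [Hl Hr].
  destruct (Req_dec_T x (- (PI / 2))) as [E | E]; [right; apply Heq; auto |].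
  destruct (Req_dec_T x (PI / 2)) as [E' | E']; [right; apply Heq; auto |].
  destruct (total_order_T x 0) as [[H | H] | H].
  (* Both functions are even, so negative [x] reduces to [- x]. *)
  - rewrite <- x_over_sin_opp, <- x_over_tan_opp.
    apply inequality_pos; lra.
  - right; apply Heq; auto.
  - apply inequality_pos; lra.
Qed.
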